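(* Let $\tau>0$ and let $\widetilde A$ be a minimizer of $\|Y-XB\|_F^2+2\tau\|B\|_1$ over all $p\times n$ matrices $B$. On the event $d_1(X'E)\le\tau$, we have, for every $p\times n$ matrix $B$, $$\|X\widetilde A-XA\|_F^2\le\|XB-XA\|_F^2+4\tau\|B\|_1.$$
   Context: Multivariate response regression model: $Y=XA+E$, where $Y$ is the $m\times n$ response matrix, $X$ is an $m\times p$ matrix, $A$ is an unknown $p\times n$ matrix, and $E$ is a random $m\times n$ matrix with independent entries of mean zero and variance $\sigma^2$. A prime denotes transpose, $\|C\|_F$ is the Frobenius norm, $d_1(C)\ge d_2(C)\ge\cdots$ are the singular values of $C$ in decreasing order, and $\|C\|_1=\sum_jd_j(C)$ is the nuclear norm. *)

(* Defs.v *)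
From mathcomp Require Import all_boot all_order all_algebra.
From mathcomp Require Import polyrcf.
From mathcomp Require Import all_classical all_reals all_analysis.

Set Implicit Arguments.
Unset Strict Implicit.
Unset Printing Implicit Defensive.

Import Order.TTheory GRing.Theory Num.Theory.

Local Open Scope classical_set_scope.
Local Open Scope ring_scope.

Definition frobenius_norm (R : rcfType) (m n : nat) (C : 'M[R]_(m, n)) : R :=
  Num.sqrt (\sum_i \sum_j C i j ^+ 2).

(* [rootsR p] lists each real root of p once; here each one is repeated
   according to its multiplicity. *)
Definition roots_mult (R : rcfType) (p : {poly R}) : seq R :=
  flatten [seq nseq (mup x p) x | x <- rootsR p].

(* Square roots of the eigenvalues of C'C, with multiplicity, in decreasing
   order. There are n of them for an m x n matrix, hence n - min(m, n) more
   zeros than in the convention that keeps only the first min(m, n). *)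
Definition singular_values (R : rcfType) (m n : nat) (C : 'M[R]_(m, n)) :
    seq R :=
  [seq Num.sqrt x | x <- sort >=%R (roots_mult (char_poly (C^T *m C)))].

(* d_j(C) for j >= 1, equal to 0 beyond the last singular value. *)
Definition singular_value (R : rcfType) (m n : nat) (j : nat)
    (C : 'M[R]_(m, n)) : R :=
  nth 0 (singular_values C) j.-1.

Definition nuclear_norm (R : rcfType) (m n : nat) (C : 'M[R]_(m, n)) : R :=
  \sum_(1 <= j < (size (singular_values C)).+1) singular_value j C.

Definition mutually_independent (d : measure_display) (T : measurableType d)
    (R : realType) (P : probability T R) (I : finType)
    (X : I -> {RV P >-> R}) : Prop :=
  forall (J : {set I}) (S : I -> set R), (forall i, measurable (S i)) ->
    P (\bigcap_(i in [set` J]) (X i @^-1` S i)) =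
    (\prod_(i in J) P (X i @^-1` S i))%E.

(* Finiteness of the second moments is part of the variance equation, as
   sigma ^+ 2 is a real number. *)
Definition noise_matrix (d : measure_display) (T : measurableType d)
    (R : realType) (P : probability T R) (m n : nat) (sigma : R)
    (E : 'I_m * 'I_n -> {RV P >-> R}) : Prop :=
  [/\ mutually_independent E,
      forall ij, ('E_P[E ij] = 0)%E &
      forall ij, ('V_P[E ij] = (sigma ^+ 2)%:E)%E].

Definition rv_matrix (d : measure_display) (T : measurableType d)
    (R : realType) (P : probability T R) (m n : nat)
    (E : 'I_m * 'I_n -> {RV P >-> R}) (w : T) : 'M[R]_(m, n) :=
  \matrix_(i, j) E (i, j) w.

Definition penalized_loss (R : rcfType) (m p n : nat) (X : 'M[R]_(m, p))
    (Y : 'M[R]_(m, n)) (tau : R) (B : 'M[R]_(p, n)) : R :=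
  frobenius_norm (Y - X *m B) ^+ 2 + 2 * tau * nuclear_norm B.

Definition is_minimizer (U : Type) (R : realType) (f : U -> R) (x : U) : Prop :=
  forall y, f x <= f y.

(* Main.v *)
(* Comparing the penalized losses of the minimizer and of B leaves the noise
   term 2 tr((X'E)' (Atilde - B)). By the duality |tr(M'C)| <= d_1(M) ||C||_1,
   its Atilde part is absorbed by the penalty of Atilde, and its B part doubles
   the penalty of B. For the duality, tr(M'C) is computed in an orthonormal
   eigenbasis (v_j) of C'C as the sum of <M v_j, C v_j>, where
   |M v_j| <= d_1(M) and |C v_j| is a singular value of C. Real matrices are
   embedded in R[i] in order to use the spectral theorem available there. *)

Require Import Defs.
From mathcomp Require Import all_boot all_order all_algebra.
From mathcomp Require Import polyrcf complex.
From mathcomp Require Import all_classical all_reals all_analysis.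
From mathcomp Require Import ring lra.

Import Order.TTheory GRing.Theory Num.Theory.

Local Open Scope classical_set_scope.
Local Open Scope ring_scope.

(** Occurrences are counted value by value: [rootsR] has no duplicates, so a root x appears
    [mup x q] times in [roots_mult], and for a split polynomial this multiplicity is the count of x
    in [s]. *)
Lemma roots_mult_prod_XsubC (R : rcfType) (s : seq R) :
  perm_eq (roots_mult (\prod_(x <- s) ('X - x%:P))) s.
Proof.
set q := \prod_(x <- s) _.
have q0 : q != 0 by apply: monic_neq0; exact: monic_prod_XsubC.
apply/allP => x _ /=; apply/eqP.
rewrite /roots_mult count_flatten -map_comp.
rewrite (eq_map (g := fun y => if y == x then mup x q else 0%N)); last first.
  by move=> y /=; rewrite count_nseq /=; case: eqP => [->|]; rewrite ?mul1n.
rewrite -[RHS]mu_prod_XsubC -/q sumnE big_map -big_mkcond -big_filter.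
have [rx|nrx] := boolP (root q x).
  rewrite filter_pred1_uniq ?big_seq1 ?uniq_roots //.
  by have := roots_on_rootsR q0 x; rewrite in_itv /= rx => <-.
by rewrite (mupNroot nrx) big1_seq.
Qed.

Lemma char_poly_conj {F : comUnitRingType} {n} {A D U : 'M[F]_n} :
  U \in unitmx -> A = invmx U *m D *m U -> char_poly A = char_poly D.
Proof.
move=> Uu ->; rewrite /char_poly.
pose V := map_mx polyC U; pose W := map_mx polyC (invmx U).
have WV : W *m V = 1%:M by rewrite -map_mxM mulVmx // map_mx1.
have -> : char_poly_mx (invmx U *m D *m U) = W *m char_poly_mx D *m V.
  rewrite /char_poly_mx mulmxBr mulmxBl !map_mxM -/V -/W.
  by rewrite mul_mx_scalar -scalemxAl WV scalemx1.
by rewrite !det_mulmx mulrAC -det_mulmx WV det1 mul1r.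
Qed.

Local Open Scope sesquilinear_scope.

(** For unitary [W] the weights sum to 1 by [unitarymx_row_norm], so the entry is a convex
    combination of the entries of [s]. *)
Lemma diag_conjmxE (C : numClosedFieldType) m n (W : 'M[C]_(m, n)) (s : 'rV_n) j :
  (W *m diag_mx s *m W^t*) j j = \sum_i `|W j i| ^+ 2 * s 0 i.
Proof.
rewrite mxE; apply: eq_bigr => i _.
by rewrite mul_mx_diag !mxE normCK mulrAC.
Qed.

Lemma unitarymx_row_norm {C : numClosedFieldType} {m n} (W : 'M[C]_(m, n)) j :
  W \is unitarymx -> \sum_i `|W j i| ^+ 2 = 1.
Proof.
move=> /unitarymxP /matrixP/(_ j j).
rewrite mxE [RHS]mxE eqxx mulr1n => <-; apply: eq_bigr => i _.
by rewrite !mxE normCK.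
Qed.

Lemma gram_diag_ge0 {C : numClosedFieldType} {m n} (G : 'M[C]_(m, n)) j :
  0 <= (G *m G^t*) j j.
Proof.
by rewrite mxE; apply: sumr_ge0 => i _; rewrite !mxE -normCK exprn_ge0.
Qed.

(** Each diagonal entry of [G *m H^t*] is an inner product of two rows, to which Cauchy-Schwarz
    applies. *)
Lemma mxtrace_norm_le {C : numClosedFieldType} {m n} (G H : 'M[C]_(m, n)) :
  `|\tr (G *m H^t*)| <=
  \sum_j sqrtC ((G *m G^t*) j j) * sqrtC ((H *m H^t*) j j).
Proof.
have dE (K L : 'M[C]_(m, n)) j : (K *m L^t*) j j = dotmx (row j K) (row j L).
  by rewrite dotmxE !mxE; apply: eq_bigr => k _; rewrite !mxE.
apply: le_trans (ler_norm_sum _ _ _) _; apply: ler_sum => j _.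
by rewrite !dE; case: (CauchySchwarz_sqrt (@dotmx C n) (row j G) (row j H)).
Qed.

Lemma mxtrace_conj_unitary {C : numClosedFieldType} {n} (U A : 'M[C]_n) :
  U \is unitarymx -> \tr (U *m A *m U^t*) = \tr A.
Proof. by move=> Uu; rewrite -mulmxA mxtrace_mulC mulmxKtV. Qed.

Section Complexification.
Context {R : rcfType}.
Local Notation cmx := (map_mx (real_complex R)).

Lemma map_real_complex_conjC m n (A : 'M[R]_(m, n)) : (cmx A)^t* = cmx A^T.
Proof. by apply/matrixP => i j; rewrite !mxE; exact: conjc_real. Qed.

(** Row j of [W *m (cmx K)^t*] is the conjugate transpose of K v_j, where v_j is column j of [W^t*].
    Inner products of images of the v_j are thus entries of a conjugate of [K^T *m L]. *)
Lemma mul_conjmx_gram {m n} (K L : 'M[R]_(m, n)) (W : 'M[_]_n) :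
  (W *m (cmx K)^t*) *m (W *m (cmx L)^t*)^t* = W *m cmx (K^T *m L) *m W^t*.
Proof.
by rewrite trmx_mul map_mxM trmxCK map_real_complex_conjC map_mxM !mulmxA.
Qed.

(** The spectral theorem is applied to the complexified Gram matrix. The basis [U] may be complex,
    but the eigenvalues are real because the matrix is Hermitian, and nonnegative because they are
    diagonal entries of a Gram matrix. *)
Lemma gram_spectral {m n} (B : 'M[R]_(m, n)) :
  exists (U : 'M[R[i]]_n) (r : 'rV[R]_n),
  [/\ U \is unitarymx, forall j, 0 <= r 0 j,
      U *m cmx (B^T *m B) *m U^t* = diag_mx (cmx r) &
      perm_eq (roots_mult (char_poly (B^T *m B))) [seq r 0 j | j <- enum 'I_n]].
Proof.
set S := B^T *m B; set U := spectralmx (cmx S).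
have Uu : U \is unitarymx by exact: spectral_unitarymx.
have hS : cmx S \is hermsymmx.
  apply/is_hermitianmxP; rewrite expr0 scale1r -[RHS]/((cmx S)^t*).
  by rewrite map_real_complex_conjC /S trmx_mul trmxK.
have /orthomx_spectralP := hermitian_normalmx hS.
rewrite -/U; set d := spectral_diag _ => SE.
have USU : U *m cmx S *m U^t* = diag_mx d.
  rewrite SE -invmx_unitary // !mulmxA mulmxV ?unitarymx_unit // mul1mx.
  by rewrite mulmxK ?unitarymx_unit.
have dr j : d 0 j \is Num.real.
  by have /mxOverP := hermitian_spectral_diag_real hS; exact.
pose r := \row_j complex.Re (d 0 j).
have dE : d = cmx r.
  by apply/rowP => j; rewrite !mxE; have /complex_realP[x ->] := dr j.
have d_ge0 j : 0 <= d 0 j.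
  have := congr1 (fun M : 'M[_]_n => M j j) USU.
  rewrite -mul_conjmx_gram [RHS]mxE eqxx mulr1n => <-; exact: gram_diag_ge0.
exists U, r; split => //.
- by move=> j; rewrite -ler0c; have := d_ge0 j; rewrite dE mxE.
- by rewrite -dE.
(* The factorization holds over [R[i]] with real roots, and descends to R since the embedding of
   polynomials is injective. *)
have -> : char_poly S = \prod_(x <- [seq r 0 j | j <- enum 'I_n]) ('X - x%:P).
  apply: (@map_poly_inj _ _ (real_complex R)).
  rewrite map_char_poly (char_poly_conj (unitarymx_unit Uu) SE) //.
  rewrite char_poly_trig ?diag_mx_is_trig // rmorph_prod big_map /= big_enum /=.
  by apply: eq_bigr => j _; rewrite map_polyXsubC dE !mxE eqxx mulr1n.
exact: roots_mult_prod_XsubC.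
Qed.

Lemma sqrtC_real (x : R) : 0 <= x -> sqrtC (x%:C)%C = (Num.sqrt x)%:C%C.
Proof.
move=> x0; rewrite -{1}(sqr_sqrtr x0) rmorphXn /= sqrCK //.
by rewrite ler0c sqrtr_ge0.
Qed.

Lemma nuclear_normE {m n} {B : 'M[R]_(m, n)} {r : 'I_n -> R} :
  perm_eq (roots_mult (char_poly (B^T *m B))) [seq r j | j <- enum 'I_n] ->
  nuclear_norm B = \sum_j Num.sqrt (r j).
Proof.
(* Shifting the index cancels the [j.-1] of [singular_value]; the sum then runs over the whole
   sequence, whose order is irrelevant. *)
move=> Br; rewrite /nuclear_norm big_add1 /= -(big_nth 0 xpredT id) /=.
rewrite big_map (perm_big [seq r j | j <- enum 'I_n]) ?perm_sort //.
by rewrite big_map big_enum.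
Qed.

Lemma sqrt_root_le_singular_value1 {m n} (M : 'M[R]_(m, n)) x :
  x \in roots_mult (char_poly (M^T *m M)) -> Num.sqrt x <= singular_value 1 M.
Proof.
rewrite /singular_value /singular_values nth0 -(mem_sort >=%R).
set s := roots_mult _; have : sorted >=%R (sort >=%R s).
  exact: (sort_sorted ge_total).
case: (sort _ _) => //= y t; rewrite (path_sortedE ge_trans) => /andP[/allP ty _].
rewrite inE => /orP[/eqP -> //|/ty xy]; exact: ler_wsqrtr.
Qed.

(** This is |M v| <= d_1(M) for a unit vector v: expanded in an eigenbasis of M'M, |M v|^2 is a
    convex combination of eigenvalues, each at most d_1(M)^2. *)
Lemma gram_diag_le_singular_value1 {m n} (M : 'M[R]_(m, n)) (U : 'M[_]_n) j :
  U \is unitarymx ->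
  (U *m cmx (M^T *m M) *m U^t*) j j <= (singular_value 1 M ^+ 2)%:C%C.
Proof.
move=> Uu; have [V [s [Vu s0 Vs sM]]] := gram_spectral M.
(* [W] holds the coordinates of the rows of [U] in the eigenbasis [V]. *)
have [W Wu UW] : exists2 W : 'M[R[i]]_n, W \is unitarymx & U = W *m V.
  exists (U *m V^t*); last by rewrite mulmxKtV.
  by rewrite mul_unitarymx ?trmxC_unitary.
have -> : U *m cmx (M^T *m M) *m U^t* = W *m diag_mx (cmx s) *m W^t*.
  by rewrite UW -Vs trmx_mul (map_mxM Num.conj) !mulmxA.
rewrite diag_conjmxE -[leRHS]mul1r -(unitarymx_row_norm _ j Wu) mulr_suml.
apply: ler_sum => i _; apply: ler_wpM2l; first exact: exprn_ge0.
have st : Num.sqrt (s 0 i) <= singular_value 1 M.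
  apply: sqrt_root_le_singular_value1; rewrite (perm_mem sM).
  by apply: map_f; rewrite mem_enum.
rewrite mxE lecR -(sqr_sqrtr (s0 i)).
by rewrite lerXn2r ?nnegrE ?sqrtr_ge0 // (le_trans _ st) ?sqrtr_ge0.
Qed.

Lemma singular_value_ge0 {m n} j (M : 'M[R]_(m, n)) : 0 <= singular_value j M.
Proof.
rewrite /singular_value; have [h|h] := ltnP j.-1 (size (singular_values M)).
  by have /mapP[x _ ->] := mem_nth 0 h; exact: sqrtr_ge0.
by rewrite nth_default.
Qed.

Lemma nuclear_norm_ge0 {m n} (B : 'M[R]_(m, n)) : 0 <= nuclear_norm B.
Proof. by apply: sumr_ge0 => j _; exact: singular_value_ge0. Qed.

Lemma trace_le_singular_value_nuclear {m n} (M B : 'M[R]_(m, n)) :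
  `|\tr (M^T *m B)| <= singular_value 1 M * nuclear_norm B.
Proof.
have [U [r [Uu r0 Ur /nuclear_normE ->]]] := gram_spectral B.
have normCE (x : R) : `|x%:C%C| = `|x|%:C%C.
  by rewrite normc_def /= expr0n addr0 sqrtr_sqr.
rewrite -lecR -normCE -(trace_map_mx (real_complex R)).
rewrite -(mxtrace_conj_unitary _ (cmx _) Uu) -mul_conjmx_gram.
apply: le_trans (mxtrace_norm_le _ _) _.
rewrite rmorphM rmorph_sum mulr_sumr; apply: ler_sum => j _.
(* [U] diagonalizes B'B, so the second factor is exactly the root of [r 0 j]; the first one is only
   bounded, by d_1(M). *)
rewrite !mul_conjmx_gram Ur [X in _ * sqrtC X]mxE eqxx.
rewrite mulr1n [X in _ * sqrtC X]mxE sqrtC_real //.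
apply: ler_wpM2r; first by rewrite ler0c sqrtr_ge0.
have t0 := singular_value_ge0 1 M.
rewrite -[leRHS]sqrCK ?ler0c // -rmorphXn ler_sqrtC ?nnegrE.
- exact: gram_diag_le_singular_value1.
- by rewrite -mul_conjmx_gram gram_diag_ge0.
- by rewrite ler0c exprn_ge0.
Qed.

End Complexification.

Lemma frobenius_norm_sqr {R : rcfType} {m n} (C : 'M[R]_(m, n)) :
  frobenius_norm C ^+ 2 = \tr (C^T *m C).
Proof.
rewrite sqr_sqrtr; last by do 2!apply: sumr_ge0 => ? _; exact: sqr_ge0.
rewrite exchange_big; apply: eq_bigr => j _.
by rewrite mxE; apply: eq_bigr => i _; rewrite mxE.
Qed.

Lemma frobenius_norm_sqrB {R : rcfType} {m n} (C D : 'M[R]_(m, n)) :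
  frobenius_norm (C - D) ^+ 2 =
  frobenius_norm C ^+ 2 - 2 * \tr (C^T *m D) + frobenius_norm D ^+ 2.
Proof.
have DC : \tr (D^T *m C) = \tr (C^T *m D).
  by rewrite -mxtrace_tr trmx_mul trmxK.
rewrite !frobenius_norm_sqr [(C - D)^T]linearB /= mulmxBl !mulmxBr !linearB /= DC.
ring.
Qed.

Theorem theorem10 (R : realType) (d : measure_display) (T : measurableType d)
    (P : probability T R) (m p n : nat) (X : 'M[R]_(m, p)) (A : 'M[R]_(p, n))
    (sigma : R) (E : 'I_m * 'I_n -> {RV P >-> R})
    (hE : noise_matrix sigma E)
    (Y : T -> 'M[R]_(m, n)) (hY : forall w, Y w = X *m A + rv_matrix E w)
    (tau : R) (htau : 0 < tau)
    (Atilde : T -> 'M[R]_(p, n))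
    (hAtilde : forall w, is_minimizer (penalized_loss X (Y w) tau) (Atilde w)) :
  forall w, singular_value 1 (X^T *m rv_matrix E w) <= tau ->
  forall B : 'M[R]_(p, n),
    frobenius_norm (X *m Atilde w - X *m A) ^+ 2
      <= frobenius_norm (X *m B - X *m A) ^+ 2 + 4 * tau * nuclear_norm B.
Proof.
move=> w d1 B; have := hAtilde w B; rewrite /penalized_loss hY.
set N := rv_matrix E w in d1 *.
(* Once the squares are expanded, the squared norm of [N] appears on both sides and cancels; by
   [noiseE], so does the trace term in [A]. *)
have resE (C : 'M[R]_(p, n)) : X *m A + N - X *m C = N - (X *m C - X *m A).
  by rewrite opprB addrA [N + _]addrC.
have noiseE (C : 'M[R]_(p, n)) :
    \tr (N^T *m (X *m C - X *m A)) =
    \tr ((X^T *m N)^T *m C) - \tr ((X^T *m N)^T *m A).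
  by rewrite trmx_mul trmxK mulmxBr linearB /= !mulmxA.
have dual (C : 'M[R]_(p, n)) : `|\tr ((X^T *m N)^T *m C)| <= tau * nuclear_norm C.
  apply: le_trans (trace_le_singular_value_nuclear _ C) _.
  by rewrite ler_wpM2r ?nuclear_norm_ge0.
rewrite !resE !frobenius_norm_sqrB !noiseE.
(* The trace at [Atilde w] needs its upper bound and the trace at [B] its lower bound, as they enter
   with opposite signs. *)
move: (dual (Atilde w)) (dual B); rewrite !ler_norml => /andP[_ ?] /andP[? _] ?.
lra.
Qed.
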